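(* Let $N$ be a regular ruled surface in $E^3$ with parametrization $\vec r(s,v)=\vec c(s)+v\vec q(s)$, $\|\vec q(s)\|=1$, where $\vec c$ is the striction curve of $N$ and $s$ is the arc length parameter of $\vec c$, with Frenet frame $\{\vec q,\vec h,\vec a\}$ and non-zero invariants $k_1,k_2$. Then $N$ is an $h$-slant ruled surface if and only if the function $$\frac{k_1^2}{\left(k_1^2+k_2^2\right)^{3/2}}\left(\frac{k_2}{k_1}\right)'$$ is constant.
   Context: $E^3$ is Euclidean 3-space; all maps are smooth and defined on an open interval $I\subset\mathbb R$. $N$ is given by $\vec r(s,v)=\vec c(s)+v\vec q(s)$, where $\vec c$ is a unit speed curve and $\vec q$ is a unit vector field along $\vec c$ (the ruling). ''Regular'' refers to the base curve $\vec c$ being a regular curve. That $\vec c$ is the striction curve means $\langle \vec c\,',\vec q\,'\rangle=0$. Frenet frame of $N$: $\vec a=\dfrac{\vec q\times\vec q\,'}{\|\vec q\,'\|}$ (central tangent), $\vec h=\vec a\times\vec q$ (central normal). The invariants $k_1,k_2$ are the functions in the Frenet formulae $$\vec q\,'=k_1\vec h,\qquad \vec h'=-k_1\vec q+k_2\vec a,\qquad \vec a'=-k_2\vec h,$$ with $'=d/ds$; both are assumed non-zero. $N$ is called $h$-slant if the central normal $\vec h$ makes a constant angle $\varphi\neq\pi/2$ with a fixed non-zero direction, i.e. there is a fixed unit vector $\vec u$ with $\langle\vec h(s),\vec u\rangle=\cos\varphi=$ constant, $\varphi\neq\pi/2$.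
   Formalization: ''Is constant'' is replaced by ''is a non-zero constant'': since φ ≠ π/2 is required, the claim fails when the function is identically 0, e.g. c=(0,0,s), q=(cos √2s, sin √2s, 1)/√2, where k1=k2=1 but N is not h-slant. *)

(* Defs.v *)
From HB Require Import structures.
From mathcomp Require Import all_boot all_order all_algebra.
From mathcomp Require Import all_classical all_reals all_analysis.

Set Implicit Arguments.
Unset Strict Implicit.
Unset Printing Implicit Defensive.

Import Order.TTheory GRing.Theory Num.Theory.
Import numFieldNormedType.Exports.

Local Open Scope classical_set_scope.
Local Open Scope ring_scope.

(* The library norm on row vectors is the sup norm, hence the explicit
   Euclidean structure on 'rV[R]_3. *)
Definition dot (R : realType) (u v : 'rV[R]_3) : R :=
  \sum_(i < 3) u ord0 i * v ord0 i.

Definition enorm (R : realType) (u : 'rV[R]_3) : R := Num.sqrt (dot u u).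

(* The indices i + 1 and i + 2 are taken modulo 3. *)
Definition cross (R : realType) (u v : 'rV[R]_3) : 'rV[R]_3 :=
  \row_(i < 3)
    (u ord0 (i + 1) * v ord0 (i + 2) - u ord0 (i + 2) * v ord0 (i + 1)).

Definition open_interval (R : realType) (I : set R) : Prop :=
  [/\ open I, is_interval I & I !=set0].

Definition smooth_on (R : realType) (V : normedModType R)
    (I : set R) (f : R -> V) : Prop :=
  forall (n : nat) (s : R), I s -> derivable (f^`(n)%classic) s 1.

(* Curves are total functions on R; only their values on dom N are relevant. *)
Record ruled_surface (R : realType) := RuledSurface {
  dom : set R;
  base : R -> 'rV[R]_3;
  ruling : R -> 'rV[R]_3
}.

Definition param (R : realType) (N : ruled_surface R) (s v : R) : 'rV[R]_3 :=
  base N s + v *: ruling N s.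

Definition regular (R : realType) (N : ruled_surface R) : Prop :=
  forall s, dom N s -> (base N)^`()%classic s != 0.

Definition arclength_param (R : realType) (N : ruled_surface R) : Prop :=
  forall s, dom N s -> enorm ((base N)^`()%classic s) = 1.

Definition unit_ruling (R : realType) (N : ruled_surface R) : Prop :=
  forall s, dom N s -> enorm (ruling N s) = 1.

Definition base_is_striction (R : realType) (N : ruled_surface R) : Prop :=
  forall s, dom N s ->
    dot ((base N)^`()%classic s) ((ruling N)^`()%classic s) = 0.

(* Needed for the Frenet frame to exist, because of the division by ||q'||. *)
Definition has_frenet_frame (R : realType) (N : ruled_surface R) : Prop :=
  forall s, dom N s -> (ruling N)^`()%classic s != 0.

Definition central_tangent (R : realType) (N : ruled_surface R) (s : R) :
    'rV[R]_3 :=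
  (enorm ((ruling N)^`()%classic s))^-1 *:
    cross (ruling N s) ((ruling N)^`()%classic s).

Definition central_normal (R : realType) (N : ruled_surface R) (s : R) :
    'rV[R]_3 :=
  cross (central_tangent N s) (ruling N s).

Definition frenet_invariants (R : realType) (N : ruled_surface R)
    (k1 k2 : R -> R) : Prop :=
  forall s, dom N s ->
  [/\ (ruling N)^`()%classic s = k1 s *: central_normal N s,
      (central_normal N)^`()%classic s =
        - k1 s *: ruling N s + k2 s *: central_tangent N s
    & (central_tangent N)^`()%classic s = - k2 s *: central_normal N s].

(* phi is an angle between unit vectors, hence the range [0, pi]: without it
   phi = 3 pi / 2 would reintroduce the excluded case cos phi = 0. *)
Definition h_slant (R : realType) (N : ruled_surface R) : Prop :=
  exists (u : 'rV[R]_3) (phi : R),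
    [/\ enorm u = 1, 0 <= phi <= pi, phi != pi / 2
      & forall s, dom N s -> dot (central_normal N s) u = cos phi].

Definition slant_function (R : realType) (k1 k2 : R -> R) (s : R) : R :=
  k1 s ^+ 2 / ((k1 s ^+ 2 + k2 s ^+ 2) `^ (3 / 2)) *
  (fun t => k2 t / k1 t)^`()%classic s.

(* Main.v *)
(* Write kap = sqrt (k1^2 + k2^2), sl for the slant function and
   D = (k2 q + k1 a) / kap, the normalized Darboux vector of the frame.  Since
   (k1 / kap)' = - k2 sl and (k2 / kap)' = k1 sl, one gets D' = - sl h', and for
   a fixed vector u the derivative of (k1 <q, u> - k2 <a, u>) / kap is
   kap (<h, u> - sl <D, u>).
   If <h, u> is a constant c, then k1 <q, u> = k2 <a, u>, so <D, u> is a constant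
   w and c = sl w; as c != 0, sl = c / w is a non-zero constant.
   If sl is a non-zero constant C, then D + C h is a constant vector of norm
   sqrt (1 + C^2), whose scalar product with h is C. *)
Require Import Defs.
From mathcomp Require Import all_boot all_order all_algebra.
From mathcomp Require Import all_classical all_reals all_analysis.
From mathcomp Require Import ring.
Import Order.TTheory GRing.Theory Num.Theory.
Import numFieldNormedType.Exports.
Local Open Scope classical_set_scope.
Local Open Scope ring_scope.

Set Implicit Arguments.
Unset Strict Implicit.
Unset Printing Implicit Defensive.

Lemma sumr_sqr_gt0 (R : realDomainType) (x y : R) :
  x != 0 -> 0 < x ^+ 2 + y ^+ 2.
Proof. by move=> x0; rewrite ltr_pwDl ?sqr_ge0// exprn_even_gt0. Qed.

(** * Euclidean algebra of dot and cross products in coordinates *)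

Section Vectors.
Variable R : realType.
Implicit Types (u v w : 'rV[R]_3) (a : R).

Lemma dotE u v : dot u v =
  u ord0 0 * v ord0 0 + u ord0 1 * v ord0 1 + u ord0 2 * v ord0 2.
Proof.
rewrite /dot !big_ord_recl big_ord0 addr0 addrA.
by congr (_ + u _ _ * v _ _ + u _ _ * v _ _); apply: val_inj.
Qed.

Lemma crossE u v :
  [/\ cross u v ord0 0 = u ord0 1 * v ord0 2 - u ord0 2 * v ord0 1,
      cross u v ord0 1 = u ord0 2 * v ord0 0 - u ord0 0 * v ord0 2
    & cross u v ord0 2 = u ord0 0 * v ord0 1 - u ord0 1 * v ord0 0].
Proof.
by split; rewrite mxE; congr (u _ _ * v _ _ - u _ _ * v _ _); apply: val_inj.
Qed.

Lemma dotC u v : dot u v = dot v u.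
Proof. by rewrite !dotE; ring. Qed.

Lemma dotDl u v w : dot (u + v) w = dot u w + dot v w.
Proof. by rewrite !dotE !mxE; ring. Qed.

Lemma dotZl a u v : dot (a *: u) v = a * dot u v.
Proof. by rewrite !dotE !mxE; ring. Qed.

Lemma dotZr a u v : dot u (a *: v) = a * dot u v.
Proof. by rewrite dotC dotZl dotC. Qed.

Lemma dot_crossl u v : dot (cross u v) u = 0.
Proof. by rewrite dotE; have [-> -> ->] := crossE u v; ring. Qed.

Lemma dot_crossr u v : dot (cross u v) v = 0.
Proof. by rewrite dotE; have [-> -> ->] := crossE u v; ring. Qed.

(** Lagrange's identity; it yields the unit length of the central tangent and the central normal. *)
Lemma dot_cross_cross u v :
  dot (cross u v) (cross u v) = dot u u * dot v v - dot u v ^+ 2.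
Proof. by rewrite !dotE; have [-> -> ->] := crossE u v; ring. Qed.

Lemma dot_ge0 u : 0 <= dot u u.
Proof. by apply: sumr_ge0 => i _; rewrite -expr2 sqr_ge0. Qed.

Lemma dot_gt0 u : u != 0 -> 0 < dot u u.
Proof.
move=> u0; rewrite lt_def dot_ge0 andbT; apply: contra u0.
rewrite /dot psumr_eq0 => [/allP h|i _]; last by rewrite -expr2 sqr_ge0.
apply/eqP/rowP => i; rewrite mxE; apply/eqP.
by have := h i (mem_index_enum i); rewrite -expr2 sqrf_eq0.
Qed.

Lemma sqr_enorm u : enorm u ^+ 2 = dot u u.
Proof. by rewrite sqr_sqrtr ?dot_ge0. Qed.

Lemma enorm_gt0 u : u != 0 -> 0 < enorm u.
Proof. by move=> u0; rewrite sqrtr_gt0 dot_gt0. Qed.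

End Vectors.

(** * Differentiation of vector-valued curves, reduced to coordinates *)

Section VectorDerivatives.
Variable R : realType.
Implicit Types (f g : R -> 'rV[R]_3) (k : R -> R) (s : R).

Lemma is_derive_coord f s df i :
  is_derive s 1 f df -> is_derive s 1 (fun t => f t ord0 i) (df ord0 i).
Proof.
move=> [fd fe]; split; first by move/derivable_mxP : fd; exact.
by rewrite -fe derive_mx// mxE.
Qed.

Lemma is_derive_dot f g s df dg :
  is_derive s 1 f df -> is_derive s 1 g dg ->
  is_derive s 1 (fun t => dot (f t) (g t)) (dot df (g s) + dot (f s) dg).
Proof.
move=> fd gd.
have H i := is_deriveM (is_derive_coord i fd) (is_derive_coord i gd).
have -> : (fun t => dot (f t) (g t)) =
    (fun t => f t ord0 0) * (fun t => g t ord0 0) +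
    (fun t => f t ord0 1) * (fun t => g t ord0 1) +
    (fun t => f t ord0 2) * (fun t => g t ord0 2).
  by apply/funext => t; rewrite dotE.
apply: (is_derive_eq (is_deriveD (is_deriveD (H 0) (H 1)) (H 2))).
by rewrite !dotE /GRing.scale/=; ring.
Qed.

Lemma derivable_dot f g s : derivable f s 1 -> derivable g s 1 ->
  derivable (fun t => dot (f t) (g t)) s 1.
Proof. by move=> /derivableP fd /derivableP gd; case: (is_derive_dot fd gd). Qed.

Lemma derivable_cross f g s : derivable f s 1 -> derivable g s 1 ->
  derivable (fun t => cross (f t) (g t)) s 1.
Proof.
move=> /derivable_mxP fd /derivable_mxP gd; apply/derivable_mxP => i j.
under eq_fun do rewrite mxE.
by apply: derivableB; apply: derivableM.
Qed.

Lemma derivable_scale k f s : derivable k s 1 -> derivable f s 1 ->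
  derivable (fun t => k t *: f t) s 1.
Proof.
move=> kd /derivable_mxP fd; apply/derivable_mxP => i j.
under eq_fun do rewrite mxE.
exact: derivableM.
Qed.

Lemma derivable_enorm f s : f s != 0 -> derivable f s 1 ->
  derivable (fun t => enorm (f t)) s 1.
Proof.
move=> f0 /derivableP fd.
by case: (is_derive1_comp (is_derive1_sqrt (dot_gt0 f0)) (is_derive_dot fd fd)).
Qed.

End VectorDerivatives.

(** Mean value theorem on the segment [[s, t]], which lies in [I] because [I] is an interval. *)
Lemma is_derive0_cst_on (R : realType) (I : set R) (f : R -> R) :
  is_interval I -> (forall s, I s -> is_derive s 1 f 0) ->
  forall s t, I s -> I t -> f s = f t.
Proof.
move=> itvI df s t; wlog st : s t / s <= t.
  by move=> W Is It; case/orP: (le_total s t) => [|] /W ->.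
move=> Is It.
have Ist x : x \in `[s, t] -> I x by rewrite in_itv/= => ?; apply: (itvI s t).
have d x : x \in `]s, t[ -> is_derive x 1 f 0 by move=> /subset_itv_oo_cc/Ist/df.
have c : {within `[s, t], continuous f}.
  by apply: derivable_within_continuous => x /Ist/df[].
have [_ _] := @MVT_segment R f (fun=> 0) s t st d c.
by rewrite mul0r => /eqP; rewrite subr_eq0 => /eqP.
Qed.

(** * Scalar differential equations behind the Darboux vector *)

Section FrenetODE.
Variables (R : realType) (k1 k2 : R -> R).
Implicit Types (s : R) (x y z : R -> R).

Let kap s := Num.sqrt (k1 s ^+ 2 + k2 s ^+ 2).

(** The pair [(k1 / kap, k2 / kap)] is a point of the unit circle; its polar angle has derivative
    [(k1 k2' - k2 k1') / kap ^+ 2], which is [kap] times the slant function. *)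
Lemma is_derive_normalized s dk1 dk2 : k1 s != 0 ->
  is_derive s 1 k1 dk1 -> is_derive s 1 k2 dk2 ->
  is_derive s 1 (fun t => k1 t / kap t) (- k2 s * slant_function k1 k2 s) /\
  is_derive s 1 (fun t => k2 t / kap t) (k1 s * slant_function k1 k2 s).
Proof.
move=> k10 d1 d2.
have S0 : 0 < k1 s ^+ 2 + k2 s ^+ 2 by exact: sumr_sqr_gt0.
have K0 : kap s != 0 by rewrite gt_eqF ?sqrtr_gt0.
have K2 : kap s ^+ 2 = k1 s ^+ 2 + k2 s ^+ 2 by rewrite sqr_sqrtr ?ltW.
have dS := is_deriveD (is_deriveM d1 d1) (is_deriveM d2 d2).
have S0' : 0 < (k1 * k1 + k2 * k2) s by rewrite /GRing.mul/= /GRing.add/= -!expr2.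
have dK : is_derive s 1 kap ((k1 s * dk1 + k2 s * dk2) / kap s).
  have := is_derive1_comp (is_derive1_sqrt S0') dS.
  have -> : (k1 * k1 + k2 * k2) s = k1 s ^+ 2 + k2 s ^+ 2 by [].
  move=> H; apply: (is_derive_eq H); rewrite /GRing.scale/= -/(kap s).
  by field.
have dV := is_deriveV K0 dK.
have dV1 := is_deriveV k10 d1.
have slE : slant_function k1 k2 s = (k1 s * dk2 - k2 s * dk1) / kap s ^+ 3.
  rewrite /slant_function derive1E.
  have [_ ->] := is_deriveM d2 dV1.
  (* Splitting the exponent turns the real power into [kap ^+ 2 * kap], a form accessible to
     [field]. *)
  rewrite (_ : 3 / 2 = 1 + 2^-1) ?powRD ?powRr1 ?powR12_sqrt ?ltW//; last first.
  - by field.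
  - by rewrite (gt_eqF S0) implybT.
  rewrite -/(kap s) -K2 /GRing.scale/=; field.
  by rewrite k10 K0.
split.
  apply: (is_derive_eq (is_deriveM d1 dV)); apply/eqP; rewrite -subr_eq0 slE.
  (* [field] treats [kap s] as a free variable, so the difference of both sides is factored through
     [kap ^+ 2 - (k1 ^+ 2 + k2 ^+ 2)], zero by [K2]. *)
  rewrite [X in X == 0](_ : _ =
    dk1 * (kap s ^+ 2 - (k1 s ^+ 2 + k2 s ^+ 2)) / kap s ^+ 3).
    by rewrite K2 subrr mulr0 mul0r.
  by rewrite /GRing.scale/=; field.
apply: (is_derive_eq (is_deriveM d2 dV)); apply/eqP; rewrite -subr_eq0 slE.
rewrite [X in X == 0](_ : _ =
  dk2 * (kap s ^+ 2 - (k1 s ^+ 2 + k2 s ^+ 2)) / kap s ^+ 3).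
  by rewrite K2 subrr mulr0 mul0r.
by rewrite /GRing.scale/=; field.
Qed.

(** Here [x], [y], [z] stand for the scalar products of [q], [h], [a] with a fixed vector. The terms
    in [y] cancel in the first derivative and add up to [(k1 ^+ 2 + k2 ^+ 2) / kap * y] in the
    second. *)
Lemma is_derive_darboux s x y z : k1 s != 0 ->
  derivable k1 s 1 -> derivable k2 s 1 ->
  is_derive s 1 x (k1 s * y s) -> is_derive s 1 z (- k2 s * y s) ->
  let w t := k2 t / kap t * x t + k1 t / kap t * z t in
  is_derive s 1 w (slant_function k1 k2 s * (k1 s * x s - k2 s * z s)) /\
  is_derive s 1 (fun t => k1 t / kap t * x t - k2 t / kap t * z t)
    (kap s * (y s - slant_function k1 k2 s * w s)).
Proof.
move=> k10 /derivableP d1 /derivableP d2 dx dz w.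
have K0 : kap s != 0 by rewrite gt_eqF// sqrtr_gt0 sumr_sqr_gt0.
have K2 : kap s ^+ 2 = k1 s ^+ 2 + k2 s ^+ 2.
  by rewrite sqr_sqrtr// addr_ge0 ?sqr_ge0.
have [p1 p2] := is_derive_normalized k10 d1 d2.
split.
  apply: (is_derive_eq (is_deriveD (is_deriveM p2 dx) (is_deriveM p1 dz))).
  by rewrite /GRing.scale/=; field.
apply: (is_derive_eq (is_deriveB (is_deriveM p1 dx) (is_deriveM p2 dz))).
have -> : kap s * (y s - slant_function k1 k2 s * w s) =
   kap s ^+ 2 * y s / kap s - slant_function k1 k2 s * (w s * kap s).
  by field.
by rewrite K2 /w /GRing.scale/=; field.
Qed.

End FrenetODE.

(** * Orthonormality and differentiability of the frame *)

Section RuledSurface.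
Variables (R : realType) (N : ruled_surface R).
Hypotheses (hI : open_interval (dom N)) (hq : smooth_on (dom N) (ruling N)).
Hypotheses (hunit : unit_ruling N) (hframe : has_frenet_frame N).

Local Notation I := (dom N).
Local Notation q := (ruling N).
Local Notation h := (central_normal N).
Local Notation a := (central_tangent N).
Local Notation dq := ((ruling N)^`()%classic).

Lemma near_dom s : I s -> \forall t \near s, I t.
Proof. by case: hI => oI _ _ Is; exact: open_nbhs_nbhs. Qed.

Lemma is_derive_ruling s : I s -> is_derive s 1 q (dq s).
Proof. by move=> /(@hq 0)/derivableP; rewrite derive1E. Qed.

Lemma derivable_druling s : I s -> derivable dq s 1.
Proof. exact: (@hq 1 _). Qed.

(** Since [dom N] is open, [f] agrees with the constant near [s]. This is what allows relations
    valid only on [dom N] to be differentiated. *)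
Lemma is_derive_eq_cst (f : R -> R) s c df :
  I s -> is_derive s 1 f df -> (forall t, I t -> f t = c) -> df = 0.
Proof.
move=> Is fd fc; have : is_derive s 1 (cst c) df.
  apply: near_eq_is_derive fd; apply: filterS (near_dom Is) => t; exact: fc.
by case=> _ <-; rewrite derive_cst.
Qed.

Lemma dot_ruling s : I s -> dot (q s) (q s) = 1.
Proof. by move=> Is; rewrite -sqr_enorm hunit// expr1n. Qed.

Lemma dot_ruling_druling s : I s -> dot (q s) (dq s) = 0.
Proof.
move=> Is; have dqs := is_derive_ruling Is.
have := is_derive_eq_cst Is (is_derive_dot dqs dqs) dot_ruling.
by rewrite [dot (dq s) _]dotC -mulr2n => /eqP; rewrite mulrn_eq0 => /eqP.
Qed.

Lemma dot_tangent_ruling s : dot (a s) (q s) = 0.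
Proof. by rewrite dotZl dot_crossl mulr0. Qed.

Lemma dot_tangent_druling s : dot (a s) (dq s) = 0.
Proof. by rewrite dotZl dot_crossr mulr0. Qed.

(** As [q] is a unit vector orthogonal to [q'], Lagrange's identity gives [q] x [q'] the same norm
    as [q']. *)
Lemma dot_tangent s : I s -> dot (a s) (a s) = 1.
Proof.
move=> Is; rewrite dotZl dotZr dot_cross_cross dot_ruling// dot_ruling_druling//.
have := enorm_gt0 (hframe Is); rewrite -sqr_enorm => /gt_eqF n0.
by field; rewrite n0.
Qed.

Lemma dot_normal_ruling s : dot (h s) (q s) = 0.
Proof. exact: dot_crossr. Qed.

Lemma dot_normal_tangent s : dot (h s) (a s) = 0.
Proof. exact: dot_crossl. Qed.

Lemma dot_normal s : I s -> dot (h s) (h s) = 1.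
Proof.
move=> Is; rewrite dot_cross_cross dot_tangent// dot_ruling//.
by rewrite dot_tangent_ruling; ring.
Qed.

Lemma derivable_tangent s : I s -> derivable a s 1.
Proof.
move=> Is; have dqs := derivable_druling Is; have dq0 := hframe Is.
have n0 : enorm (dq s) != 0 by rewrite gt_eqF ?enorm_gt0.
have dV := @derivableV _ _ (fun t => enorm (dq t)) s 1 n0
  (derivable_enorm dq0 dqs).
have dC := derivable_cross (@hq 0 _ Is) dqs.
exact: (derivable_scale dV dC).
Qed.

Lemma derivable_normal s : I s -> derivable h s 1.
Proof.
move=> Is; exact: (derivable_cross (derivable_tangent Is) (@hq 0 _ Is)).
Qed.

(** * Differentiability of the invariants, known only through the Frenet formulae *)

Variables k1 k2 : R -> R.
Hypothesis hfrenet : frenet_invariants N k1 k2.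

(** Expresses [k1] through differentiable fields, whence its own differentiability. *)
Lemma dot_druling_normal s : I s -> dot (dq s) (h s) = k1 s.
Proof.
by move=> Is; have [-> _ _] := hfrenet Is; rewrite dotZl dot_normal// mulr1.
Qed.

Lemma derivable_k1 s : I s -> derivable k1 s 1.
Proof.
move=> Is; apply: (@near_eq_derivable _ _ _ (fun t => dot (dq t) (h t))).
  by apply: filterS (near_dom Is) => t; exact: dot_druling_normal.
by apply: derivable_dot; [exact: derivable_druling|exact: derivable_normal].
Qed.

Lemma is_derive_tangent s : I s -> is_derive s 1 a (- k2 s *: h s).
Proof.
move=> Is; have [_ _ <-] := hfrenet Is; rewrite derive1E.
exact/derivableP/derivable_tangent.
Qed.

Lemma is_derive_normal s : I s ->
  is_derive s 1 h (- k1 s *: q s + k2 s *: a s).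
Proof.
move=> Is; have [_ <- _] := hfrenet Is; rewrite derive1E.
exact/derivableP/derivable_normal.
Qed.

(** Obtained by differentiating [dot (a t) (dq t) = 0] and inserting the formula for [a']. Dividing
    by [k1] then recovers [k2] from [q''] and [a]. *)
Lemma dot_d2ruling_tangent s : I s ->
  dot (dq^`()%classic s) (a s) = k1 s * k2 s.
Proof.
move=> Is; have /derivableP := derivable_druling Is.
rewrite -derive1E => d2.
have := is_derive_eq_cst Is (is_derive_dot (is_derive_tangent Is) d2)
  (fun t _ => dot_tangent_druling t).
rewrite dotZl [dot (h s) _]dotC dot_druling_normal// [dot (a s) _]dotC => E.
by apply/eqP; rewrite -subr_eq0 -E; apply/eqP; ring.
Qed.

Hypothesis hk1 : forall s, I s -> k1 s != 0.

Lemma derivable_k2 s : I s -> derivable k2 s 1.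
Proof.
move=> Is.
apply: (@near_eq_derivable _ _ _
  (fun t => dot (dq^`()%classic t) (a t) * (k1 t)^-1)).
  apply: filterS (near_dom Is) => t It.
  by rewrite dot_d2ruling_tangent// mulrAC mulfV ?mul1r// hk1.
apply: derivableM.
  by apply: derivable_dot; [exact: (@hq 2 _)|exact: derivable_tangent].
by apply: derivableV; [exact: hk1|exact: derivable_k1].
Qed.

(** * The normalized Darboux vector against a fixed vector *)

Let kap s := Num.sqrt (k1 s ^+ 2 + k2 s ^+ 2).

Let D s : 'rV[R]_3 := (k2 s / kap s) *: q s + (k1 s / kap s) *: a s.

Lemma dot_darboux s u :
  dot (D s) u = k2 s / kap s * dot (q s) u + k1 s / kap s * dot (a s) u.
Proof. by rewrite dotDl !dotZl. Qed.

Lemma is_derive_dot_frenet s u : I s ->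
  [/\ is_derive s 1 (fun t => dot (q t) u) (k1 s * dot (h s) u),
      is_derive s 1 (fun t => dot (h t) u)
        (- k1 s * dot (q s) u + k2 s * dot (a s) u)
    & is_derive s 1 (fun t => dot (a t) u) (- k2 s * dot (h s) u)].
Proof.
move=> Is; have d0 : is_derive s 1 (cst u) 0 by exact: is_derive_cst.
have dot0 v : dot v 0 = 0 :> R by rewrite -(scale0r v) dotZr mul0r.
split.
- apply: (is_derive_eq (is_derive_dot (is_derive_ruling Is) d0)).
  by have [-> _ _] := hfrenet Is; rewrite dotZl dot0 addr0.
- apply: (is_derive_eq (is_derive_dot (is_derive_normal Is) d0)).
  by rewrite dotDl !dotZl dot0 addr0.
- apply: (is_derive_eq (is_derive_dot (is_derive_tangent Is) d0)).
  by rewrite dotZl dot0 addr0.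
Qed.

Lemma is_derive_dot_darboux s u : I s ->
  is_derive s 1 (fun t => dot (D t) u)
    (slant_function k1 k2 s * (k1 s * dot (q s) u - k2 s * dot (a s) u)) /\
  is_derive s 1
    (fun t => k1 t / kap t * dot (q t) u - k2 t / kap t * dot (a t) u)
    (kap s * (dot (h s) u - slant_function k1 k2 s * dot (D s) u)).
Proof.
move=> Is; have [dx _ dz] := is_derive_dot_frenet u Is.
have -> : (fun t => dot (D t) u) =
    (fun t => k2 t / kap t * dot (q t) u + k1 t / kap t * dot (a t) u).
  by apply/funext => t; exact: dot_darboux.
rewrite dot_darboux.
exact: (is_derive_darboux (y := fun t => dot (h t) u)
  (hk1 Is) (derivable_k1 Is) (derivable_k2 Is) dx dz).
Qed.

(** * The two implications *)

Lemma h_slant_slant_function : h_slant N ->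
  exists2 C : R, C != 0 & forall s, I s -> slant_function k1 k2 s = C.
Proof.
move=> [u [phi [_ phiI phiN hu]]].
have c0 : cos phi != 0 :> R.
  (* On [[0, pi]] the cosine is injective, so it vanishes only at [pi / 2]. *)
  apply: contra phiN => /eqP; rewrite -(@cos_pihalf R) => /cos_inj -> //.
  rewrite in_itv/= divr_ge0 ?pi_ge0//= ler_pdivrMr// ler_peMr ?pi_ge0//.
  by rewrite ler1n.
(* This is the derivative of the constant [dot (h s) u], up to sign. *)
have k12 s : I s -> k1 s * dot (q s) u - k2 s * dot (a s) u = 0.
  move=> Is; have [_ dh _] := is_derive_dot_frenet u Is.
  by rewrite -[RHS]oppr0 -(is_derive_eq_cst Is dh hu); ring.
have [_ itvI [s0 Is0]] := hI.
have [w Dw] : exists w, forall s, I s -> dot (D s) u = w.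
  exists (dot (D s0) u) => s Is.
  apply: (@is_derive0_cst_on _ _ (fun x => dot (D x) u) itvI) => // x Ix.
  have [dD _] := is_derive_dot_darboux u Ix.
  by move: dD; rewrite k12// mulr0.
(* The function in [P0] is zero on [dom N], hence so is its derivative [kap * (cos phi - sl * w)],
   where [sl] is the slant function and [kap] is positive. *)
have slw s : I s -> slant_function k1 k2 s * w = cos phi.
  move=> Is; have [_ dP] := is_derive_dot_darboux u Is.
  have P0 t : I t ->
      k1 t / kap t * dot (q t) u - k2 t / kap t * dot (a t) u = 0.
    by move=> It; rewrite mulrAC [X in _ - X]mulrAC -mulrBl k12// mul0r.
  have /eqP := is_derive_eq_cst Is dP P0.
  rewrite hu// Dw// mulf_eq0 gt_eqF ?subr_eq0/= => [/eqP //|].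
  by rewrite sqrtr_gt0 sumr_sqr_gt0 ?hk1.
have w0 : w != 0.
  by apply: contra c0 => /eqP w0; rewrite -(slw _ Is0) w0 mulr0.
exists (cos phi / w) => [|s Is]; first by rewrite mulf_neq0// invr_neq0.
by apply: (mulIf w0); rewrite divfK// slw.
Qed.

Lemma slant_function_h_slant C : C != 0 ->
  (forall s, I s -> slant_function k1 k2 s = C) -> h_slant N.
Proof.
move=> C0 slC; have [_ itvI [s0 Is0]] := hI.
pose V s := D s + C *: h s.
have dotV s u : dot (V s) u = dot (D s) u + C * dot (h s) u.
  by rewrite dotDl dotZl.
(* Both summands of the derivative are multiples of [k1 <q, u> - k2 <a, u>], with opposite factors
   [C] and [- C]. *)
have Vcst u s : I s -> dot (V s) u = dot (V s0) u.
  move=> Is; apply: (@is_derive0_cst_on _ _ (fun x => dot (V x) u) itvI) => // t It.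
  have [dD _] := is_derive_dot_darboux u It.
  have [_ dh _] := is_derive_dot_frenet u It.
  have -> : (fun t => dot (V t) u) =
      (fun t => dot (D t) u) + C \*: (fun t => dot (h t) u).
    by apply/funext => x; exact: dotV.
  apply: (is_derive_eq (is_deriveD dD (is_deriveZ _ dh))).
  by rewrite slC// /GRing.scale/=; ring.
have Dh s : dot (D s) (h s) = 0.
  rewrite dot_darboux ![dot _ (h s)]dotC dot_normal_ruling dot_normal_tangent.
  by ring.
have Vh s : I s -> dot (V s0) (h s) = C.
  by move=> Is; rewrite -(Vcst _ s)// dotV Dh dot_normal// add0r mulr1.
(* The mixed terms drop out because [q] and [a] are orthogonal; [(k2 ^+ 2 + k1 ^+ 2) / kap ^+ 2]
   remains. *)
have DD : dot (D s0) (D s0) = 1.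
  rewrite dot_darboux ![dot _ (D s0)]dotC !dot_darboux.
  rewrite dot_ruling// dot_tangent// [dot (q s0) (a s0)]dotC dot_tangent_ruling.
  have S0 : 0 < k1 s0 ^+ 2 + k2 s0 ^+ 2 by rewrite sumr_sqr_gt0 ?hk1.
  have K0 : kap s0 != 0 by rewrite gt_eqF ?sqrtr_gt0.
  have K2 : kap s0 ^+ 2 = k1 s0 ^+ 2 + k2 s0 ^+ 2 by rewrite sqr_sqrtr ?ltW.
  transitivity ((k1 s0 ^+ 2 + k2 s0 ^+ 2) / kap s0 ^+ 2); first by field.
  by rewrite K2 mulfV// gt_eqF.
have VV : dot (V s0) (V s0) = 1 + C ^+ 2.
  rewrite dotV [dot (D s0) _]dotC [dot (h s0) _]dotC Vh// dotV DD.
  by rewrite [dot (h s0) _]dotC Dh; ring.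
have n0 : 0 < enorm (V s0) by rewrite sqrtr_gt0 VV ltr_pwDl ?sqr_ge0.
have n2 : enorm (V s0) ^+ 2 = 1 + C ^+ 2 by rewrite sqr_enorm.
(* The cosine of the angle between [h] and the fixed axis [V s0]; it lies in [[-1, 1]] because
   [C ^+ 2 <= 1 + C ^+ 2]. *)
pose c := C / enorm (V s0).
have cI : -1 <= c <= 1.
  rewrite -ler_norml -(@ler_pXn2r _ 2)// ?nnegrE//.
  rewrite expr1n real_normK ?num_real// expr_div_n n2.
  by rewrite ler_pdivrMr ?mul1r ?lerDr// ltr_pwDl ?sqr_ge0.
have cosc : cos (acos c) = c by rewrite acosK// in_itv.
exists ((enorm (V s0))^-1 *: V s0), (acos c); split.
- rewrite -[LHS]/(Num.sqrt (dot _ _)) dotZl dotZr mulrA -expr2 -sqr_enorm.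
  by rewrite -exprMn mulVf ?expr1n ?sqrtr1// gt_eqF.
- by rewrite acos_ge0// acos_lepi.
(* An angle [pi / 2] would force [c = 0], hence [C = 0]. *)
- apply: contra C0 => /eqP E; move: cosc; rewrite E cos_pihalf => /esym/eqP.
  by rewrite mulf_eq0 invr_eq0 (gt_eqF n0) orbF.
- by move=> s Is; rewrite cosc dotZr dotC Vh// mulrC.
Qed.

End RuledSurface.

(** The condition [C != 0] matches the exclusion of [pi / 2]: if the slant function vanishes
    identically, [D] is a fixed direction orthogonal to [h], and by the first implication no
    admissible angle exists. *)
Theorem theorem4p1 (R : realType) (N : ruled_surface R) (k1 k2 : R -> R)
  (hI : open_interval (dom N))
  (hc : smooth_on (dom N) (base N))
  (hq : smooth_on (dom N) (ruling N))
  (hreg : regular N)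
  (harc : arclength_param N)
  (hunit : unit_ruling N)
  (hstr : base_is_striction N)
  (hframe : has_frenet_frame N)
  (hfrenet : frenet_invariants N k1 k2)
  (hk1 : forall s, dom N s -> k1 s != 0)
  (hk2 : forall s, dom N s -> k2 s != 0) :
  h_slant N <->
  exists2 C : R, C != 0 & forall s, dom N s -> slant_function k1 k2 s = C.
Proof.
split; first exact: h_slant_slant_function.
by case=> C; exact: slant_function_h_slant.
Qed.
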